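(* Let $M\ge1$ and consider rapidities $(\nu_m,y_m)$ and inhomogeneities $(\xi_m,z_m)$, $1\le m\le M$, complex with nonzero entries and generic in the sense specified in the context. Then the domain wall partition function of type $C$, $$Z^{(C)}_M=\langle0|\,C_{1\dots M}(\nu_M,y_M)\cdots C_{1\dots M}(\nu_1,y_1)\,|1\rangle,$$ equals $$Z^{(C)}_M=\left(\frac{z_M}{y_1}\right)^{\frac{2M-1}2}\left(\frac{z_{M-1}}{y_2}\right)^{\frac{2M-3}2}\cdots\left(\frac{z_1}{y_M}\right)^{\frac12}\ \frac{\prod_{k=1}^M\sqrt{\nu_k\xi_k}\ \prod_{m,n=1}^M(\nu_m-\xi_n)}{\prod_{1\le p<q\le M}(\nu_p-\nu_q)(\xi_q-\xi_p)}\ \det\left[\frac{\rho-1}{(\nu_i\rho-\xi_j)(\nu_i-\xi_j)}\right]_{i,j=1,\dots,M}.$$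
   Context: Fix $\rho\in\mathbb C\setminus\{0,1\}$. Spectral parameters are pairs $\lambda=(\nu,y)$; for $\lambda=(\nu,y)$, $\lambda'=(\xi,z)$ the $R$-matrix is, in the ordered basis $(e_1\otimes e_1,e_1\otimes e_2,e_2\otimes e_1,e_2\otimes e_2)$ of $\mathbb C^2\otimes\mathbb C^2$, $$R(\lambda,\lambda')=\begin{pmatrix}1&0&0&0\\0&\frac{\sqrt\rho}{y}\frac{\nu-\xi}{\nu\rho-\xi}&(\rho-1)\sqrt{\frac zy}\frac{\sqrt{\nu\xi}}{\nu\rho-\xi}&0\\0&(\rho-1)\sqrt{\frac zy}\frac{\sqrt{\nu\xi}}{\nu\rho-\xi}&\sqrt\rho\,z\frac{\nu-\xi}{\nu\rho-\xi}&0\\0&0&0&\frac zy\end{pmatrix}.$$ Square roots of $\rho$ and of each $\nu_m,\xi_m,y_m,z_m$ are fixed once and for all; $\sqrt{z/y}=\sqrt z/\sqrt y$, $\sqrt{\nu\xi}=\sqrt\nu\sqrt\xi$, and half-integer powers mean the corresponding powers of these fixed roots. $R_{ai}$ acts as $R$ on $V_a\otimes V_i$ (first factor $V_a$), $V_a,V_i\cong\mathbb C^2$. The monodromy matrix is $R_{aM}((\nu,y),(\xi_M,z_M))\cdots R_{a1}((\nu,y),(\xi_1,z_1))=\begin{pmatrix}A_{1\dots M}(\nu,y)&B_{1\dots M}(\nu,y)\\C_{1\dots M}(\nu,y)&D_{1\dots M}(\nu,y)\end{pmatrix}_a$, a $2\times 2$ matrix in $V_a$. $|1\rangle=\bigotimes_{i=1}^Me_2$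 and $\langle0|$ is the transpose of $\bigotimes_{i=1}^Me_1$. Genericity: the $\nu_m$ are pairwise distinct, the $\xi_m$ are pairwise distinct, $\nu_i\neq\xi_j$, $\nu_i\rho\ne\xi_j$ for all $i,j$, and $\xi_i\rho\neq\xi_j$ for $i\ne j$. *)

(* Defs.v *)
From HB Require Import structures.
From mathcomp Require Import all_boot all_order all_algebra.
From mathcomp Require Import complex mxtens.
From mathcomp Require Import reals.

Set Implicit Arguments.
Unset Strict Implicit.
Unset Printing Implicit Defensive.

Import GRing.Theory.
Local Open Scope ring_scope.

(* A scalar [num x] together with a fixed choice [rt x] of its square root.
   The root is attached to each parameter separately, so two parameters with
   equal values may carry different roots. *)
Record rooted (F : fieldType) := Rooted {
  num : F;
  rt : F;
  rtP : rt ^+ 2 = num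
}.

(* Spectral parameters (nu, y). *)
Definition spectral (F : fieldType) := (rooted F * rooted F)%type.

Definition e1 : 'I_2 := ord0.
Definition e2 : 'I_2 := ord_max.

(* The basis vector e_i (x) e_j has index [mxtens_index (i, j)], of value
   2 * i + j: this is the order e1e1, e1e2, e2e1, e2e2. *)
Definition Rmatrix (F : fieldType) (rho : rooted F) (l l' : spectral F) :
    'M[F]_(2 * 2) :=
  let: (nu, y) := l in
  let: (xi, z) := l' in
  let d := num nu * num rho - num xi in
  let offdiag := (num rho - 1) * (rt z / rt y) * ((rt nu * rt xi) / d) in
  let rows :=
    [:: [:: 1; 0; 0; 0];
        [:: 0; rt rho / num y * ((num nu - num xi) / d); offdiag; 0];
        [:: 0; offdiag; rt rho * num z * ((num nu - num xi) / d); 0];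
        [:: 0; 0; 0; num z / num y]] in
  \matrix_(i, j) (nth [::] rows i)`_j.

(* [tens F I] is the tensor product over the sites i in I of copies of F^2: a
   vector is given by its coordinates in the product basis, whose elements are
   indexed by the configurations s : I -> {e1, e2}. *)
Definition config (I : finType) := {ffun I -> 'I_2}.
Definition tens (F : fieldType) (I : finType) := {ffun config I -> F}.

Definition set2_config (I : finType) (a b : I) (s : config I) (i j : 'I_2) :
    config I :=
  [ffun c => if c == a then i else if c == b then j else s c].

(* The 4 x 4 matrix A acting on V_a (x) V_b (first factor V_a), for a != b,
   and trivially on the other sites. *)
Definition act2 (F : fieldType) (I : finType) (a b : I) (A : 'M[F]_(2 * 2))
    (v : tens F I) : tens F I :=
  [ffun s : config I => \sum_(i < 2) \sum_(j < 2)
     A (mxtens_index (s a, s b)) (mxtens_index (i, j))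
       * v (set2_config a b s i j)].

Section Monodromy.
Variables (F : fieldType) (M : nat) (rho : rooted F).
(* The k-th quantum space carries the parameter (xi_k, z_k). *)
Variable inh : 'I_M -> spectral F.

(* In V_a (x) V_1 (x) ... (x) V_M the sites are [option 'I_M], the auxiliary
   space V_a being the site [None].  The factor R_{a1} acts first. *)
Definition monodromy (l : spectral F) (v : tens F (option 'I_M)) :
    tens F (option 'I_M) :=
  foldl (fun w i => act2 None (Some i) (Rmatrix rho l (inh i)) w) v
        (enum 'I_M).

Definition aux_tensor (b : 'I_2) (v : tens F 'I_M) : tens F (option 'I_M) :=
  [ffun s : config (option 'I_M) => (s None == b)%:R * v [ffun i => s (Some i)]].

Definition aux_coord (a : 'I_2) (w : tens F (option 'I_M)) : tens F 'I_M :=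
  [ffun s : config 'I_M => w [ffun o => if o is Some i then s i else a]].

(* Entry in row a, column b of the monodromy matrix seen as a 2 x 2 matrix in
   V_a: T (e_b (x) v) = \sum_a e_a (x) (T_{ab} v). *)
Definition monodromy_entry (a b : 'I_2) (l : spectral F) (v : tens F 'I_M) :
    tens F 'I_M :=
  aux_coord a (monodromy l (aux_tensor b v)).

Definition opA := monodromy_entry e1 e1.
Definition opB := monodromy_entry e1 e2.
Definition opC := monodromy_entry e2 e1.
Definition opD := monodromy_entry e2 e2.

Definition uniform_vec (b : 'I_2) : tens F 'I_M :=
  [ffun s : config 'I_M => (s == [ffun=> b])%:R].

(* The transpose of u applied to v (no complex conjugation). *)
Definition bra (u v : tens F 'I_M) : F := \sum_s u s * v s.

(* <0| C(l_M) ... C(l_1) |1>, where C(l_1) acts first. *)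
Definition dwpf_C (l : 'I_M -> spectral F) : F :=
  bra (uniform_vec e1)
      (foldl (fun v m => opC (l m) v) (uniform_vec e2) (enum 'I_M)).

End Monodromy.

(* Main.v *)
(* Izergin-Korepin by Lagrange interpolation in the first rapidity nu_1.  With
   denominators cleared, the first row of the lattice shows that Z_M is
   sqrt(nu_1) times a polynomial of degree < M in nu_1, so that its values at
   nu_1 = xi_1, ..., xi_M determine it.  At nu_1 = xi_j for the site j on which
   R acts first, the weight b vanishes, the site j is frozen, and Z_M reduces to
   Z_(M-1) without nu_1 and xi_j; the Yang-Baxter equation, applied to
   neighbouring quantum sites, brings any site to that position at the price of
   an explicit power of the z's.  On the determinant side, multiplication by
   prod_(q > 1) (nu_1 - nu_q) gives a polynomial identity of degree 2M - 2, which
   holds at the xi_j (Laplace expansion and induction) and at the nu_q with q > 1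
   (two equal rows). *)

Require Import Defs.
From HB Require Import structures.
From mathcomp Require Import all_boot all_order all_algebra.
From mathcomp Require Import complex mxtens ring.
From mathcomp Require Import reals.

Set Implicit Arguments.
Unset Strict Implicit.
Unset Printing Implicit Defensive.

Import GRing.Theory.
Local Open Scope ring_scope.

Lemma ord2_ind (P : 'I_2 -> Prop) : P e1 -> P e2 -> forall i, P i.
Proof.
move=> P1 P2 [[|[|//]] lti].
- by rewrite (_ : Ordinal lti = e1) //; apply: val_inj.
- by rewrite (_ : Ordinal lti = e2) //; apply: val_inj.
Qed.

Lemma sum_ord2 (V : nmodType) (f : 'I_2 -> V) : \sum_(i < 2) f i = f e1 + f e2.
Proof.
rewrite big_ord_recl big_ord1; congr (_ + f _).
exact: val_inj.
Qed.

(** * Weights and the Yang-Baxter equation *)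

Section Weights.
Variables (F : fieldType) (rho : rooted F).
Implicit Types l : spectral F.

(** Six-vertex weights: [wt_a] belongs to e2e2, [wt_b] and [wt_b'] to e1e2 and e2e1 left unchanged,
    [wt_c] to their exchange; e1e1 has weight 1. *)
Definition wt_den l l' := num l.1 * num rho - num l'.1.
Definition wt_a l l' := num l'.2 / num l.2.
Definition wt_b l l' := rt rho / num l.2 * ((num l.1 - num l'.1) / wt_den l l').
Definition wt_b' l l' := rt rho * num l'.2 * ((num l.1 - num l'.1) / wt_den l l').
Definition wt_c l l' :=
  (num rho - 1) * (rt l'.2 / rt l.2) * ((rt l.1 * rt l'.1) / wt_den l l').

Lemma RmatrixE l l' p q p' q' :
  Rmatrix rho l l' (mxtens_index (p, q)) (mxtens_index (p', q')) =
  if (p == p') && (q == q') then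
    if p == e1 then (if q == e1 then 1 else wt_b l l')
    else if q == e1 then wt_b' l l' else wt_a l l'
  else if (p == q') && (q == p') then wt_c l l' else 0.
Proof.
case: l l' => nu y [xi z]; rewrite mxE /wt_a /wt_b /wt_b' /wt_c /wt_den /=.
by elim/ord2_ind: p; elim/ord2_ind: q; elim/ord2_ind: p'; elim/ord2_ind: q'.
Qed.

End Weights.

Lemma ord2_neq : (e1 == e2 = false) * (e2 == e1 = false).
Proof. by []. Qed.

Lemma rt_neq0 (F : fieldType) (x : rooted F) : num x != 0 -> rt x != 0.
Proof. by rewrite -(rtP x) expf_eq0. Qed.

Section YangBaxter.
Variables (F : fieldType) (rho : rooted F) (I : finType).

Lemma act2_RmatrixE (a b : I) (l m : spectral F) (v : tens F I) t :
  act2 a b (Rmatrix rho l m) v t =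
  if t a == e1 then
    if t b == e1 then v (set2_config a b t e1 e1)
    else wt_b rho l m * v (set2_config a b t e1 e2)
         + wt_c rho l m * v (set2_config a b t e2 e1)
  else if t b == e1 then
         wt_c rho l m * v (set2_config a b t e1 e2)
         + wt_b' rho l m * v (set2_config a b t e2 e1)
       else wt_a l m * v (set2_config a b t e2 e2).
Proof.
rewrite ffunE !sum_ord2 !RmatrixE.
move: (t a) (t b) => p q.
elim/ord2_ind: p; elim/ord2_ind: q;
  by rewrite /= ?ord2_neq /= ?mul0r ?add0r ?addr0 ?mul1r.
Qed.

(** Only the sites [a], [b], [c] are affected, so for each of the eight values there the claim is a
    scalar identity in eight coordinates of [v], checked by [field]. *)
Lemma yang_baxter (a b c : I) (l m n : spectral F) (v : tens F I) :
    a != b -> a != c -> b != c ->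
    wt_den rho l m != 0 -> wt_den rho l n != 0 -> wt_den rho m n != 0 ->
    num l.2 != 0 -> num m.2 != 0 ->
  act2 b c (Rmatrix rho m n) (act2 a c (Rmatrix rho l n)
    (act2 a b (Rmatrix rho l m) v)) =
  act2 a b (Rmatrix rho l m) (act2 a c (Rmatrix rho l n)
    (act2 b c (Rmatrix rho m n) v)).
Proof.
move=> ab ac bc dlm dln dmn yl ym; apply/ffunP=> t.
have [ba ca cb] : [/\ b != a, c != a & c != b] by split; rewrite eq_sym.
(* [g] runs through the configurations that agree with [t] off [a], [b], [c]. *)
pose g p q r : config I :=
  [ffun x => if x == a then p else if x == b then q
             else if x == c then r else t x].
have gab p q r i j : set2_config a b (g p q r) i j = g i j r.
  by apply/ffunP=> x; rewrite !ffunE; case: (x == a) => //; case: (x == b).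
have gac p q r i j : set2_config a c (g p q r) i j = g i q j.
  apply/ffunP=> x; rewrite !ffunE; case: (x == a) => //.
  by case: (eqVneq x c) => // ->; rewrite (negPf cb).
have gbc p q r i j : set2_config b c (g p q r) i j = g p i j.
  apply/ffunP=> x; rewrite !ffunE.
  case: (eqVneq x b) => [->|_]; first by rewrite (negPf ba).
  by case: (eqVneq x c) => [->|//]; rewrite (negPf ca).
have ga p q r : g p q r a = p by rewrite ffunE eqxx.
have gb p q r : g p q r b = q by rewrite ffunE (negPf ba) eqxx.
have gc p q r : g p q r c = r by rewrite ffunE (negPf ca) (negPf cb) eqxx.
have -> : t = g (t a) (t b) (t c).
  apply/ffunP=> x; rewrite ffunE; case: eqVneq => [->|_] //.
  by case: eqVneq => [->|_] //; case: eqVneq => [->|_].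
have yl' := rt_neq0 yl; have ym' := rt_neq0 ym.
move: (t a) (t b) (t c) => p q r.
clearbody g.
(* One application of R, the third site being fixed, as four rewriting rules on coordinates. *)
pose rule (k1 k2 : spectral F) (u w : tens F I) (h : 'I_2 -> 'I_2 -> config I) :=
  ((w (h e1 e1) = u (h e1 e1))%R * (w (h e2 e2) = wt_a k1 k2 * u (h e2 e2))%R *
   (w (h e1 e2) = wt_b rho k1 k2 * u (h e1 e2) + wt_c rho k1 k2 * u (h e2 e1))%R *
   (w (h e2 e1) = wt_c rho k1 k2 * u (h e1 e2) + wt_b' rho k1 k2 * u (h e2 e1))%R)%type.
have hab u r' : rule l m u (act2 a b (Rmatrix rho l m) u) (fun p q => g p q r').
  by rewrite /rule !act2_RmatrixE !(ga, gb) !gab.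
have hac u q' : rule l n u (act2 a c (Rmatrix rho l n) u) (fun p r => g p q' r).
  by rewrite /rule !act2_RmatrixE !(ga, gc) !gac.
have hbc u p' : rule m n u (act2 b c (Rmatrix rho m n) u) (fun q r => g p' q r).
  by rewrite /rule !act2_RmatrixE !(gb, gc) !gbc.
set v1 := act2 a b _ v; set v2 := act2 a c _ v1; set w1 := act2 b c _ v.
set w2 := act2 a c _ w1.
move: (hab v) (hac v1) (hbc v2) (hbc v) (hac w1) (hab w2) => {hab hac hbc}.
rewrite -/v1 -/v2 -/w1 -/w2 /rule {ga gb gc gab gac gbc}.
move: v1 v2 (act2 b c _ v2) w1 w2 (act2 a b _ w2)
  => v1 v2 v3 w1 w2 w3 E1 E2 E3 F1 F2 F3.
elim/ord2_ind: p; elim/ord2_ind: q; elim/ord2_ind: r;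
  rewrite E3 ?F3 !E2 ?F2 ?E1 ?F1.
all: move: (v (g e1 e1 e1)) (v (g e1 e1 e2)) (v (g e1 e2 e1)) (v (g e2 e1 e1))
  (v (g e1 e2 e2)) (v (g e2 e2 e1)) (v (g e2 e1 e2)) (v (g e2 e2 e2)) => ????????.
all: clear -yl' ym' dlm dln dmn yl ym.
(* With every [num] written as the square of its root, the identities become rational in independent
   variables. *)
all: move: dlm dln dmn yl ym; rewrite /wt_a /wt_b /wt_b' /wt_c /wt_den;
  rewrite -!rtP;
  move: (rt rho) (rt l.1) (rt l.2) (rt m.1) (rt m.2) (rt n.1) (rt n.2) yl' ym';
  move=> r2 nu2 y2 xi2 z2 th2 u2 yl' ym' dlm dln dmn yl ym.
- by [].
all: by field; rewrite ?exprMn ?yl' ?ym' ?dlm ?dln ?dmn.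
Qed.
End YangBaxter.

(** * Linearity, locality and basis-vector action of two-site operators *)

Section Act2.
Variables (F : fieldType) (I : finType).
Implicit Types (v w : tens F I) (A B : 'M[F]_(2 * 2)).

Lemma act2E (a b : I) A v s : act2 a b A v s =
  \sum_(i < 2) \sum_(j < 2) A (mxtens_index (s a, s b)) (mxtens_index (i, j))
       * v (set2_config a b s i j).
Proof. by rewrite ffunE. Qed.

(** Two terms suffice, since R sends a product basis vector to at most two of them; a multiple of
    [v] is written [lincomb x v 0 v]. *)
Definition lincomb (x : F) v (y : F) w : tens F I :=
  [ffun s => x * v s + y * w s].

Lemma act2_lincomb (a b : I) A x v y w :
  act2 a b A (lincomb x v y w) = lincomb x (act2 a b A v) y (act2 a b A w).
Proof.
apply/ffunP=> s; rewrite !ffunE !sum_ord2 !ffunE; ring.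
Qed.

Lemma act2_commute (a b c d : I) A B v :
    a != c -> a != d -> b != c -> b != d ->
  act2 a b A (act2 c d B v) = act2 c d B (act2 a b A v).
Proof.
move=> ac ad bc bd; apply/ffunP=> s.
have setC i j k l : set2_config c d (set2_config a b s i j) k l =
    set2_config a b (set2_config c d s k l) i j.
  apply/ffunP=> x; rewrite !ffunE.
  case: (eqVneq x a) => [->|_]; first by rewrite (negPf ac) (negPf ad).
  by case: (eqVneq x b) => [->|_]; first by rewrite (negPf bc) (negPf bd).
have sab i j : (set2_config c d s i j a = s a) * (set2_config c d s i j b = s b).
  by split; rewrite !ffunE !(negPf ac, negPf ad, negPf bc, negPf bd).
have scd i j : (set2_config a b s i j c = s c) * (set2_config a b s i j d = s d).
  by split; rewrite !ffunE ![_ == a]eq_sym ![_ == b]eq_sym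
    !(negPf ac, negPf ad, negPf bc, negPf bd).
rewrite !(act2E, sum_ord2) !(sab, scd) !setC; ring.
Qed.

Definition ket (c : config I) : tens F I := [ffun t => (t == c)%:R].

Definition agree_off (a b : I) (s t : config I) :=
  [forall x, (x != a) && (x != b) ==> (s x == t x)].

(** Separates the values at [a] and [b] from a part that [set2_config a b] leaves unchanged, so that
    the action on kets reduces to a case analysis at two sites. *)
Lemma config_eq_off (a b : I) (s t : config I) :
  (s == t) = [&& s a == t a, s b == t b & agree_off a b s t].
Proof.
apply/eqP/and3P => [->|[/eqP sa /eqP sb /forallP st]].
  by split=> //; apply/forallP=> x; apply/implyP.
apply/ffunP=> x; have := st x.
case: (eqVneq x a) => [->//|_]; case: (eqVneq x b) => [->//|_] /=.
by move/eqP.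
Qed.

Lemma agree_off_set2l (a b : I) (s t : config I) p q :
  agree_off a b (set2_config a b s p q) t = agree_off a b s t.
Proof.
by apply: eq_forallb => x; rewrite ffunE; case: (x == a); case: (x == b).
Qed.

Lemma agree_off_set2r (a b : I) (s t : config I) p q :
  agree_off a b s (set2_config a b t p q) = agree_off a b s t.
Proof.
by apply: eq_forallb => x; rewrite ffunE; case: (x == a); case: (x == b).
Qed.

Lemma set2_configE (a b : I) (t : config I) p q : a != b ->
  (set2_config a b t p q a = p) * (set2_config a b t p q b = q).
Proof. by move=> ab; rewrite !ffunE !eqxx eq_sym (negPf ab). Qed.

Lemma act2_Rmatrix_ket22 rho (a b : I) l l' (c : config I) :
    a != b -> c a = e2 -> c b = e2 ->
  act2 a b (Rmatrix rho l l') (ket c) = lincomb (wt_a l l') (ket c) 0 (ket c).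
Proof.
move=> ab ca cb; apply/ffunP=> t; rewrite act2_RmatrixE !ffunE.
rewrite !(config_eq_off a b _ c) !agree_off_set2l !set2_configE // ca cb.
by move: (t a) (t b); elim/ord2_ind; elim/ord2_ind; rewrite /=; ring.
Qed.

Lemma act2_Rmatrix_ket12 rho (a b : I) l l' (c : config I) :
    a != b -> c a = e1 -> c b = e2 ->
  act2 a b (Rmatrix rho l l') (ket c) =
  lincomb (wt_b rho l l') (ket c)
          (wt_c rho l l') (ket (set2_config a b c e2 e1)).
Proof.
move=> ab ca cb; apply/ffunP=> t; rewrite act2_RmatrixE !ffunE.
rewrite !(config_eq_off a b) !agree_off_set2l agree_off_set2r !set2_configE //.
rewrite ca cb.
by move: (t a) (t b); elim/ord2_ind; elim/ord2_ind; rewrite /=; ring.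
Qed.

End Act2.

(** * Monodromy along a list of sites *)

Section Sites.
Variables (F : fieldType) (M : nat) (rho : rooted F) (inh : 'I_M -> spectral F).
Implicit Types (v : tens F 'I_M) (w : tens F (option 'I_M)) (s : seq 'I_M).
Implicit Types (l : spectral F) (i k : 'I_M) (c : config 'I_M).

Lemma aux_tensor_lincomb b x v y v' :
  aux_tensor b (lincomb x v y v') =
  lincomb x (aux_tensor b v) y (aux_tensor b v').
Proof. by apply/ffunP=> t; rewrite !ffunE; ring. Qed.

Lemma aux_coord_lincomb b x w y w' :
  aux_coord b (lincomb x w y w') = lincomb x (aux_coord b w) y (aux_coord b w').
Proof. by apply/ffunP=> t; rewrite !ffunE. Qed.

Lemma aux_tensor_act2 b i k A v :
  aux_tensor b (act2 i k A v) = act2 (Some i) (Some k) A (aux_tensor b v).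
Proof.
apply/ffunP=> t; rewrite !ffunE mulr_sumr; apply: eq_bigr => p _.
rewrite mulr_sumr; apply: eq_bigr => q _; rewrite !ffunE /= mulrCA.
congr (_ * (_ * v _)); apply/ffunP=> x; rewrite !ffunE.
by rewrite !(inj_eq Some_inj).
Qed.

Lemma aux_coord_act2 b i k A w :
  aux_coord b (act2 (Some i) (Some k) A w) = act2 i k A (aux_coord b w).
Proof.
apply/ffunP=> t; rewrite !ffunE; apply: eq_bigr => p _; apply: eq_bigr => q _.
rewrite !ffunE; congr (_ * w _); apply/ffunP=> x; rewrite !ffunE.
by case: x => [x|//]; rewrite !ffunE !(inj_eq Some_inj).
Qed.

Lemma aux_coord_tensor a b v :
  aux_coord a (aux_tensor b v) = lincomb (a == b)%:R v 0 v.
Proof.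
apply/ffunP=> t; rewrite !ffunE mul0r addr0; congr (_ * v _).
by apply/ffunP=> x; rewrite !ffunE.
Qed.

(* The sites are visited in the order of [s]; those outside [s] are spectators. *)
Definition transfer s l w :=
  foldl (fun w i => act2 None (Some i) (Rmatrix rho l (inh i)) w) w s.

(** The space stays fixed while the list varies: sites can be permuted or dropped without changing
    the type of the vectors. *)
Definition opCs s l v := aux_coord e2 (transfer s l (aux_tensor e1 v)).

Lemma transfer_cons i s l w :
  transfer (i :: s) l w =
  transfer s l (act2 None (Some i) (Rmatrix rho l (inh i)) w).
Proof. by []. Qed.

Lemma transfer_cat s1 s2 l w :
  transfer (s1 ++ s2) l w = transfer s2 l (transfer s1 l w).
Proof. exact: foldl_cat. Qed.

Lemma transfer_lincomb s l x w y w' :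
  transfer s l (lincomb x w y w') =
  lincomb x (transfer s l w) y (transfer s l w').
Proof.
by elim: s w w' => // i s IHs w w'; rewrite !transfer_cons act2_lincomb IHs.
Qed.

Lemma opCs_lincomb s l x v y v' :
  opCs s l (lincomb x v y v') = lincomb x (opCs s l v) y (opCs s l v').
Proof.
by rewrite /opCs aux_tensor_lincomb transfer_lincomb aux_coord_lincomb.
Qed.

Lemma transfer_act2 s l i k A w : i \notin s -> k \notin s ->
  act2 (Some i) (Some k) A (transfer s l w) =
  transfer s l (act2 (Some i) (Some k) A w).
Proof.
elim: s w => // j s IHs w; rewrite !inE => /norP[ij nis] /norP[kj nks].
rewrite !transfer_cons (IHs _ nis nks); congr (transfer _ _ _).
by apply: act2_commute; rewrite ?(inj_eq Some_inj).
Qed.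

(** R on the quantum sites [i], [k] commutes with the factors along [s1] and [s2], and Yang-Baxter
    with the auxiliary site carries it past the two factors between them. *)
Lemma opCs_swap s1 s2 i k l v : uniq (s1 ++ i :: k :: s2) ->
    wt_den rho l (inh i) != 0 -> wt_den rho l (inh k) != 0 ->
    wt_den rho (inh i) (inh k) != 0 ->
    num l.2 != 0 -> num (inh i).2 != 0 ->
  act2 i k (Rmatrix rho (inh i) (inh k)) (opCs (s1 ++ i :: k :: s2) l v) =
  opCs (s1 ++ k :: i :: s2) l (act2 i k (Rmatrix rho (inh i) (inh k)) v).
Proof.
rewrite cat_uniq /= negb_or negb_or inE negb_or -!andbA.
case/and5P=> _ is1 ks1 _ /and4P[ik is2 ks2 _] di dk dik ly iy.
rewrite /opCs -aux_coord_act2 aux_tensor_act2 !transfer_cat.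
rewrite !transfer_cons (transfer_act2 _ _ _ is2 ks2).
congr (aux_coord _ (transfer _ _ _)).
by rewrite -(transfer_act2 _ _ _ is1 ks1) yang_baxter ?(inj_eq Some_inj).
Qed.

(** * Action of the operators C on basis vectors *)

Definition set_config c i p : config 'I_M := [ffun x => if x == i then p else c x].

Definition aux_config b c : config (option 'I_M) :=
  [ffun o => if o is Some i then c i else b].

Lemma aux_tensor_ket b c : aux_tensor b (ket F c) = ket F (aux_config b c).
Proof.
apply/ffunP=> t; rewrite !ffunE -natrM mulnb; congr (_ %:R); congr nat_of_bool.
apply/andP/eqP => [[/eqP tb /eqP tc]|->].
  by apply/ffunP=> -[x|]; rewrite !ffunE // -tc ffunE.
by split; rewrite ?ffunE //; apply/eqP/ffunP=> x; rewrite !ffunE.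
Qed.

(** Each R meets e2e2, on which it is diagonal with weight [wt_a]. *)
Lemma transfer_ket2 s l c : (forall i, i \in s -> c i = e2) ->
  transfer s l (aux_tensor e2 (ket F c)) =
  lincomb (\prod_(i <- s) wt_a l (inh i)) (aux_tensor e2 (ket F c))
          0 (aux_tensor e2 (ket F c)).
Proof.
elim: s => [|i s IHs] cs.
  by apply/ffunP=> t; rewrite big_nil !ffunE mul0r addr0 mul1r.
have ci : c i = e2 by apply: cs; rewrite inE eqxx.
rewrite transfer_cons aux_tensor_ket act2_Rmatrix_ket22 ?ffunE //.
rewrite -aux_tensor_ket transfer_lincomb IHs => [|j js]; last first.
  by apply: cs; rewrite inE js orbT.
by apply/ffunP=> t; rewrite big_cons !ffunE; ring.
Qed.

(** The auxiliary line arrives at [i] in state e1. Either it passes with weight b and goes on along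
    [s], or it exchanges with the site and then crosses [s] in state e2, where everything is
    diagonal. *)
Lemma opCs_cons_ket i s l c : i \notin s -> c i = e2 ->
    (forall j, j \in s -> c j = e2) ->
  opCs (i :: s) l (ket F c) =
  lincomb (wt_b rho l (inh i)) (opCs s l (ket F c))
    (wt_c rho l (inh i) * \prod_(j <- s) wt_a l (inh j))
    (ket F (set_config c i e1)).
Proof.
move=> nis ci cs; rewrite /opCs transfer_cons.
rewrite !aux_tensor_ket act2_Rmatrix_ket12 ?ffunE //.
have -> : set2_config None (Some i) (aux_config e1 c) e2 e1 =
    aux_config e2 (set_config c i e1).
  by apply/ffunP=> -[x|]; rewrite !ffunE // (inj_eq Some_inj).
rewrite -!aux_tensor_ket transfer_lincomb transfer_ket2; last first.
  move=> j js; rewrite ffunE; case: eqVneq js => [->|_]; first by rewrite (negPf nis).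
  exact: cs.
rewrite !aux_coord_lincomb !aux_coord_tensor eqxx.
apply/ffunP=> t; rewrite !ffunE -[true%:R]/(1 : F); ring.
Qed.

Lemma act2_Rmatrix_e1 i k l l' v :
  act2 i k (Rmatrix rho l l') v [ffun=> e1] = v [ffun=> e1].
Proof.
rewrite act2_RmatrixE !ffunE /=; congr (v _).
by apply/ffunP=> x; rewrite !ffunE; do ?case: ifP.
Qed.

Definition site_e1 i v := forall c, c i != e1 -> v c = 0.

(** The auxiliary line enters in e1 and meets e1 at its first site, where R acts with weight 1. *)
Lemma opCs_freeze i s l v : site_e1 i v -> opCs (i :: s) l v = opCs s l v.
Proof.
move=> vi; rewrite /opCs transfer_cons; congr (aux_coord _ (transfer _ _ _)).
apply/ffunP=> t; rewrite act2_RmatrixE !ffunE /= ?ord2_neq ?eqxx.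
have v0 p : v [ffun x => set2_config None (Some i) t p e2 (Some x)] = 0.
  by apply: vi; rewrite !ffunE /= eqxx.
rewrite !v0 !mulr0 !mul0r !mulr0 !addr0.
case: eqVneq => tN; case: eqVneq => ti; rewrite ?mul0r ?mulr0 ?addr0 ?mul1r //.
  congr (v _); apply/ffunP=> x; rewrite !ffunE (inj_eq Some_inj).
  by case: (eqVneq x i) => [->|//]; rewrite ti.
by rewrite vi // ffunE.
Qed.

Lemma site_e1_opCs i s l v : i \notin s -> site_e1 i v -> site_e1 i (opCs s l v).
Proof.
move=> nis vi c ci; rewrite ffunE.
suff: forall w, (forall t : config (option 'I_M), t (Some i) != e1 -> w t = 0) ->
    forall t : config (option 'I_M), t (Some i) != e1 -> transfer s l w t = 0.
  by apply; rewrite ?ffunE // => t ti; rewrite ffunE vi ?mulr0 // ffunE.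
elim: s nis {v vi c ci} => // j s IHs; rewrite inE => /norP[ij nis] w w0.
move=> t; rewrite transfer_cons; apply: IHs => // {}t ti.
rewrite act2E !sum_ord2 !w0 ?mulr0 ?addr0 // ffunE /=;
  by rewrite (inj_eq Some_inj) (negPf ij).
Qed.
End Sites.

(** * Interpolation of the determinant *)

Section Vandermonde.
Variable F : fieldType.

Definition vdm n (x : 'I_n -> F) :=
  \prod_(p < n) \prod_(q < n | (p < q)%N) (x q - x p).

Lemma vdm_neq0 n (x : 'I_n -> F) : injective x -> vdm x != 0.
Proof.
move=> x_inj; apply/prodf_neq0 => p _; apply/prodf_neq0 => q pq.
by rewrite subr_eq0 (inj_eq x_inj) eq_sym -val_eqE ltn_eqF.
Qed.

Lemma ltn_lift n (j : 'I_n) (p q : 'I_n.-1) : (lift j p < lift j q)%N = (p < q)%N.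
Proof. by rewrite !ltnNge /= leq_bump2. Qed.

Lemma lift_ltn n (j : 'I_n) (i : 'I_n.-1) : (lift j i < j)%N = (i < j)%N.
Proof.
by rewrite /= /bump; case: (leqP j i) => // ji; rewrite add1n ltnNge leqW.
Qed.

(** The sign comes from the [j] pairs in which [j] is the larger index: their factors appear
    reversed on the right. *)
Lemma vdm_lift n (x : 'I_n.+1 -> F) (j : 'I_n.+1) :
  vdm x = (-1) ^+ j * (\prod_(i < n) (x (lift j i) - x j))
          * vdm (fun i => x (lift j i)).
Proof.
rewrite /vdm (bigD1_ord j) //=; set L := (X in X * _ = _).
under eq_bigr => p _.
  rewrite big_mkcond /= (bigD1_ord j) //=.
  under eq_bigr => q _ do rewrite ltn_lift.
  rewrite -big_mkcond /= lift_ltn.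
over.
rewrite big_split /= mulrA; congr (_ * _).
rewrite /L big_mkcond (bigD1_ord j) //= ltnn mul1r -big_split /=.
(* The sign is spread over the indices below [j] and then compared factor by factor. *)
have -> : (-1) ^+ j = \prod_(i < n) (if (i < j)%N then -1 else 1) :> F.
  rewrite -big_mkcond /= -(big_ord_widen n (fun _ => -1)) ?prodr_const ?card_ord //.
  by rewrite -ltnS.
rewrite -big_split /=; apply: eq_bigr => i _.
have := lift_ltn j i; have := neq_lift j i; rewrite -val_eqE /=.
case: ltngtP => // ij _ <-; rewrite ?mulN1r ?opprB ?mul1r ?mulr1 //.
Qed.
End Vandermonde.

(** * The Izergin determinant as a solution of the interpolation problem *)

Section Izergin.
Variables (F : fieldType) (rho : F).

Definition izergin_mx n (nu xi : 'I_n -> F) : 'M[F]_n :=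
  \matrix_(i, j) ((rho - 1) / ((nu i * rho - xi j) * (nu i - xi j))).

(** The closed formula without square roots and powers of z and y; negating [nu] inside [vdm] gives
    the factors nu_p - nu_q for p < q. *)
Definition izergin n (nu xi : 'I_n -> F) :=
  (\prod_(m < n) \prod_(k < n) (nu m - xi k))
  / (vdm (fun i => - nu i) * vdm xi) * \det (izergin_mx nu xi).

Section Step.
Variables (n : nat) (nu xi : 'I_n.+1 -> F) (P : {poly F}).
Hypotheses (nu_inj : injective nu) (xi_inj : injective xi).
Hypotheses (nuDxi : forall i j, nu i != xi j).
Hypotheses (nuMrhoDxi : forall i j, nu i * rho != xi j).

Let A := izergin_mx nu xi.
Let nu' (q : 'I_n) := nu (lift ord0 q).

(** Laplace expansion of the determinant along its first row, with the variable in place of nu_1 and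
    the denominators of that row cleared. *)
Definition izergin_num : {poly F} :=
  \sum_j ((rho - 1) * cofactor A ord0 j) *:
    \prod_(i < n) (('X - (xi (lift j i))%:P) * (rho *: 'X - (xi (lift j i))%:P)).

Lemma size_izergin_num : (size izergin_num <= n.*2.+1)%N.
Proof.
rewrite /izergin_num; apply: (leq_trans (size_sum _ _ _)).
apply/bigmax_leqP => j _; apply: (leq_trans (size_scale_leq _ _)).
apply: (leq_trans (size_poly_prod_leq _ _)).
rewrite card_ord leq_subLR addnS ltnS -addnn addnA.
apply: (@leq_trans (\sum_(i < n) 3)).
  apply: leq_sum => i _; apply: (leq_trans (size_polyMleq _ _)).
  rewrite size_XsubC /=; apply: (leq_trans (size_polyD _ _)).
  rewrite size_polyN geq_max (leq_trans (size_scale_leq _ _)) ?size_polyX //.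
  by rewrite (leq_trans (size_polyC_leq1 _)).
by rewrite sum_nat_const card_ord mulnC !mulSn mul0n addn0 addnA.
Qed.

(** Evaluating at [nu q] replaces the first row of [A] by row [q], so the determinant vanishes
    unless [q] is [ord0]. *)
Lemma horner_izergin_num_nu q : izergin_num.[nu q] =
  \prod_i ((nu q - xi i) * (nu q * rho - xi i)) * (\det A *+ (q == ord0)).
Proof.
have -> : \det A *+ (q == ord0) = \sum_j A q j * cofactor A ord0 j.
  have /matrixP/(_ q ord0) := mul_mx_adj A; rewrite !mxE => <-.
  by apply: eq_bigr => j _; rewrite [\adj A _ _]mxE.
rewrite mulr_sumr /izergin_num horner_sum; apply: eq_bigr => j _.
rewrite hornerZ horner_prod (bigD1_ord j) //= mxE.
rewrite (eq_bigr (fun i => (nu q - xi (lift j i)) * (nu q * rho - xi (lift j i))))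
  => [|i _]; last by rewrite !hornerE [rho * _]mulrC.
have n1 : nu q - xi j != 0 by rewrite subr_eq0.
have n2 : nu q * rho - xi j != 0 by rewrite subr_eq0.
by field; rewrite n1 n2.
Qed.

(** Every term of the sum except the [j]-th contains the factor X - xi_j. *)
Lemma horner_izergin_num_xi j : izergin_num.[xi j] =
  (rho - 1) * cofactor A ord0 j *
  \prod_(i < n) ((xi j - xi (lift j i)) * (xi j * rho - xi (lift j i))).
Proof.
rewrite /izergin_num horner_sum (bigD1_ord j) //=.
rewrite [X in _ + X]big1 ?addr0 => [|k _].
  rewrite hornerZ horner_prod; congr (_ * _); apply: eq_bigr => i _.
  by rewrite !hornerE [rho * _]mulrC.
rewrite hornerZ horner_prod.
have [|i ji _] := @unlift_some _ (lift j k) j; first by rewrite eq_sym neq_lift.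
by rewrite (bigD1 i) //= -ji hornerM hornerXsubC subrr !mul0r mulr0.
Qed.

Lemma izergin_interpolation : (size P <= n.+1)%N ->
    (forall j, P.[xi j] = (rho - 1) * \prod_(i < n) (xi j * rho - xi (lift j i))
       * izergin nu' (fun i => xi (lift j i))) ->
  P.[nu ord0] = \prod_i (nu ord0 * rho - xi i) * izergin nu xi.
Proof.
move=> sP Pxi.
pose v' := vdm (fun i => - nu' i).
pose K := \prod_(m < n) \prod_(j < n.+1) (nu' m - xi j).
(* The cross-multiplied difference of the two sides: [K], [v'] and [vdm xi] come from clearing the
   denominator of [izergin], and the nodes [nu'] restore the factors nu_1 - nu_q. *)
pose G := (vdm xi * v') *: (P * \prod_(q < n) ('X - (nu' q)%:P)) - K *: izergin_num.
have sign_prod (f : 'I_n -> F) x :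
    \prod_(q < n) (x - f q) = (-1) ^+ n * \prod_(q < n) (f q - x).
  rewrite -[X in _ ^+ X]card_ord -prodr_const -big_split /=.
  by apply: eq_bigr => q _; rewrite mulN1r opprB.
have nodesE x :
    (\prod_(q < n) ('X - (nu' q)%:P)).[x] = \prod_(q < n) (x - nu' q).
  by rewrite horner_prod; apply: eq_bigr => q _; rewrite hornerXsubC.
have nu'_inj : injective nu' by move=> p q /nu_inj/lift_inj.
have vxi0 := vdm_neq0 xi_inj.
have v'0 : v' != 0 by apply: vdm_neq0 => p q /oppr_inj/nu'_inj.
have G0 : G = 0.
  (* There are 2n + 1 distinct roots, while the degree is at most 2n. *)
  apply: (@roots_geq_poly_eq0 _ _ (map xi (enum 'I_n.+1) ++ map nu' (enum 'I_n))).
  - rewrite all_cat !all_map; apply/andP; split; apply/allP => j _ /=; apply/rootP.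
      rewrite /G hornerD hornerN !hornerZ hornerM Pxi.
      rewrite horner_izergin_num_xi /izergin (vdm_lift xi j).
      have vj0 : vdm (fun i : 'I_n => xi (lift j i)) != 0.
        by apply: vdm_neq0 => p q /xi_inj/lift_inj.
      rewrite -/v' (_ : cofactor A ord0 j = (-1) ^+ j *
          \det (izergin_mx nu' (fun i => xi (lift j i)))); last first.
        by rewrite /cofactor; congr (_ * \det _); apply/matrixP=> p q; rewrite !mxE.
      rewrite (_ : K = (\prod_q (nu' q - xi j)) *
          \prod_m \prod_k (nu' m - xi (lift j k))); last first.
        by rewrite -big_split; apply: eq_bigr => q _; rewrite (bigD1_ord j).
      rewrite nodesE (sign_prod nu') big_split /=.
      rewrite (sign_prod (fun i => xi (lift j i)) (xi j)).
      (* Each sign occurs once on both sides, so its value does not matter. *)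
      move: ((-1) ^+ j) ((-1) ^+ n) => e e'.
      by field; rewrite vj0 v'0.
    rewrite /G hornerD hornerN !hornerZ hornerM horner_izergin_num_nu mulr0n.
    by rewrite nodesE (bigD1 j) //= subrr mul0r !mulr0 subr0.
  - rewrite cat_uniq (map_inj_uniq xi_inj) (map_inj_uniq nu'_inj) !enum_uniq /= andbT.
    apply/hasPn => _ /mapP[q _ ->]; apply/mapP => -[j _ /eqP].
    by rewrite (negPf (nuDxi _ _)).
  rewrite size_cat (size_map xi) (size_map nu') !size_enum_ord /G.
  apply: (leq_trans (size_polyD _ _)); rewrite size_polyN geq_max.
  apply/andP; split; apply: (leq_trans (size_scale_leq _ _)); last first.
    by rewrite addSn addnn size_izergin_num.
  apply: (leq_trans (size_polyMleq _ _)).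
  by rewrite -big_enum size_prod_XsubC size_enum_ord addnS /= leq_add2r.
have := congr1 (horner^~ (nu ord0)) G0.
rewrite /G hornerD hornerN !hornerZ hornerM horner_izergin_num_nu horner0 eqxx mulr1n.
rewrite nodesE /izergin.
have -> : vdm (fun i => - nu i) = \prod_(q < n) (nu ord0 - nu' q) * v'.
  rewrite (vdm_lift _ ord0) expr0 mul1r; congr (_ * _).
  by apply: eq_bigr => q _; rewrite opprK addrC.
have -> : \prod_(m < n.+1) \prod_(k < n.+1) (nu m - xi k) =
    \prod_k (nu ord0 - xi k) * K by rewrite big_ord_recl.
rewrite big_split /= => /eqP; rewrite subr_eq0 => /eqP PE.
have nodes0 : \prod_(q < n) (nu ord0 - nu' q) != 0.
  by apply/prodf_neq0 => q _; rewrite subr_eq0 (inj_eq nu_inj) neq_lift.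
apply: (mulfI (mulf_neq0 (mulf_neq0 vxi0 v'0) nodes0)).
rewrite -[LHS]mulrA [_ * P.[_]]mulrC PE.
by field; rewrite vxi0 v'0 nodes0.
Qed.
End Step.
End Izergin.

(** Translates deletion of a site from a list into reindexing by [lift j]. Both lists in the second
    equation are strictly increasing with the same elements. *)
Lemma enum_ord_lift n (j : 'I_n.+1) : exists s1 s2,
  enum 'I_n.+1 = s1 ++ j :: s2 /\ map (lift j) (enum 'I_n) = s1 ++ s2.
Proof.
have [s1 [s2 E]] : exists s1 s2, enum 'I_n.+1 = s1 ++ j :: s2.
  by case/splitPr: (mem_enum 'I_n.+1 j) => s1 s2; exists s1, s2.
exists s1, s2; split=> //.
have -> : s1 ++ s2 = filter (predC1 j) (enum 'I_n.+1).
  have := enum_uniq 'I_n.+1; rewrite E cat_uniq /= negb_or -!andbA.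
  case/and5P=> _ js1 _ js2 _; rewrite filter_cat /= eqxx /=.
  by congr (_ ++ _); apply/esym/all_filterP/allP => x xs;
    [apply: contraNneq js1 | apply: contraNneq js2] => <-.
have ord_sorted m : sorted (relpre val ltn) (enum 'I_m).
  by rewrite -sorted_map val_enum_ord iota_ltn_sorted.
apply: (@irr_sorted_eq _ (relpre val ltn)).
- by move=> a b c; apply: ltn_trans.
- by move=> a; apply: ltnn.
- by rewrite sorted_map; apply: sub_sorted (ord_sorted n) => a b /=; rewrite ltn_lift.
- by apply: sorted_filter (ord_sorted _) => a b c; apply: ltn_trans.
move=> x; rewrite mem_filter mem_enum andbT /=; apply/mapP/idP => [[y _ ->]|].
  by rewrite eq_sym neq_lift.
by rewrite eq_sym => /unlift_some[y -> _]; exists y; rewrite ?mem_enum.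
Qed.

(** * The partition function *)

Section PartitionFunction.
Variables (F : fieldType) (M : nat) (rho : rooted F) (inh : 'I_M -> spectral F).
Implicit Types (s : seq 'I_M) (l : spectral F) (ls : seq (spectral F)).

Local Notation xi i := (num (inh i).1).
Local Notation z i := (num (inh i).2).

(** Sites off [s] are in state e1, so flipping a site of [s] to e1 gives the domain wall state of
    the shorter list. *)
Definition domain_wall s : config 'I_M := [ffun i => if i \in s then e2 else e1].

Definition opCs_iter s ls (v : tens F 'I_M) :=
  foldl (fun v l => opCs rho inh s l v) v ls.

Definition dwpf s ls := opCs_iter s ls (ket F (domain_wall s)) [ffun=> e1].

(* [zwt s / ywt ls] is the prefactor in the z's and y's: the k-th site of [s]
   contributes rt z ^ (2 k - 1), and the rapidities get the reversed exponents. *)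
Fixpoint zwt s :=
  if s is i :: s' then rt (inh i).2 * \prod_(j <- s') z j * zwt s' else 1.

Fixpoint ywt ls : F :=
  if ls is l :: ls' then rt l.2 * num l.2 ^+ size ls' * ywt ls' else 1.

Definition regular l := num l.2 != 0 /\ forall i, wt_den rho l (inh i) != 0.

Definition all_regular ls := foldr (fun l P => regular l /\ P) True ls.

Hypothesis rho1 : num rho != 1.
Hypothesis z0 : forall i, z i != 0.
Hypothesis xi0 : forall i, xi i != 0.
Hypothesis xi_inj : injective (fun i => xi i).
Hypothesis xiMrho : forall i k, wt_den rho (inh i) (inh k) != 0.

Lemma opCs_iter_lincomb s ls x v y v' :
  opCs_iter s ls (lincomb x v y v') =
  lincomb x (opCs_iter s ls v) y (opCs_iter s ls v').
Proof. by elim: ls v v' => //= l ls IHls v v'; rewrite opCs_lincomb IHls. Qed.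

Lemma opCs_iter_swap s1 s2 i k ls v : uniq (s1 ++ i :: k :: s2) ->
    all_regular ls ->
  act2 i k (Rmatrix rho (inh i) (inh k)) (opCs_iter (s1 ++ i :: k :: s2) ls v) =
  opCs_iter (s1 ++ k :: i :: s2) ls (act2 i k (Rmatrix rho (inh i) (inh k)) v).
Proof.
move=> Us; elim: ls v => // l ls IHls v [[y0 dl] reg].
by rewrite [RHS]/= -opCs_swap //; apply: IHls.
Qed.

(** R on [i], [k] has eigenvalue 1 on the final all-e1 covector and [wt_a] on the initial state,
    where both sites are e2. *)
Lemma dwpf_swap s1 s2 i k ls : uniq (s1 ++ i :: k :: s2) ->
    all_regular ls ->
  dwpf (s1 ++ i :: k :: s2) ls =
  wt_a (inh i) (inh k) * dwpf (s1 ++ k :: i :: s2) ls.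
Proof.
move=> Us reg; rewrite /dwpf -(act2_Rmatrix_e1 rho i k (inh i) (inh k)).
rewrite opCs_iter_swap //.
have -> : domain_wall (s1 ++ i :: k :: s2) = domain_wall (s1 ++ k :: i :: s2).
  by apply/ffunP=> x; rewrite !ffunE !(mem_cat, inE) [(x == i) || _]orbCA.
have ik : i != k.
  by move: Us; rewrite cat_uniq => /and3P[_ _] /=; rewrite inE negb_or => /andP[/andP[]].
rewrite act2_Rmatrix_ket22 ?ffunE ?mem_cat ?inE ?eqxx ?orbT //.
by rewrite opCs_iter_lincomb ffunE mul0r addr0.
Qed.

Lemma zwt_neq0 s : zwt s != 0.
Proof.
elim: s => [|i s IHs] /=; first exact: oner_neq0.
by rewrite !mulf_neq0 ?rt_neq0 // prodf_seq_neq0; apply/allP => j _ /=.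
Qed.

Lemma zwt_swap s1 s2 i k :
  zwt (s1 ++ i :: k :: s2) = wt_a (inh i) (inh k) * zwt (s1 ++ k :: i :: s2).
Proof.
elim: s1 => [|j s1 IHs] /=.
  rewrite !big_cons /wt_a -!(rtP (inh _).2).
  by field; rewrite rt_neq0.
rewrite IHs [in LHS](perm_big (s1 ++ k :: i :: s2)) /=; first by ring.
by rewrite perm_cat2l -[i :: k :: _]/([:: i] ++ [:: k] ++ s2) perm_catCA.
Qed.

(** Exchanging neighbours multiplies [dwpf] and [zwt] by the same factor, so their ratio ignores the
    order of the sites; [j] moves to the front one step at a time. *)
Lemma dwpf_front s1 s2 j ls : uniq (s1 ++ j :: s2) ->
    all_regular ls ->
  dwpf (s1 ++ j :: s2) ls * zwt (j :: s1 ++ s2) =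
  dwpf (j :: s1 ++ s2) ls * zwt (s1 ++ j :: s2).
Proof.
elim/last_ind: s1 s2 => [//|s1 k IHs] s2; rewrite !cat_rcons => Us reg.
have Us' : uniq (s1 ++ j :: k :: s2).
  move: Us; congr is_true; apply: perm_uniq.
  by rewrite perm_cat2l -[k :: j :: _]/([:: k] ++ [:: j] ++ s2) perm_catCA.
by rewrite dwpf_swap // -mulrA IHs // [in RHS]zwt_swap mulrCA.
Qed.

Lemma opCs_iter_freeze i s ls v : i \notin s -> site_e1 i v ->
  opCs_iter (i :: s) ls v = opCs_iter s ls v.
Proof.
move=> nis; elim: ls v => //= l ls IHls v vi.
by rewrite opCs_freeze // IHls //; apply: site_e1_opCs.
Qed.

Lemma prod_wt_a s l :
  \prod_(i <- s) wt_a l (inh i) = \prod_(i <- s) z i / num l.2 ^+ size s.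
Proof.
elim: s => [|i s IHs]; first by rewrite !big_nil expr0 divr1.
by rewrite !big_cons IHs /wt_a exprS invfM mulrACA.
Qed.

Lemma ywt_neq0 ls : all_regular ls -> ywt ls != 0.
Proof.
elim: ls => [|l ls IHls] /=; first by rewrite oner_neq0.
by case=> -[y0 _] /IHls ?; rewrite !mulf_neq0 ?rt_neq0 ?expf_neq0.
Qed.

(** Here [wt_b] vanishes, so the first C must flip site [i], which is then frozen at e1 for all
    later rapidities. *)
Lemma dwpf_cons_node i s l ls : i \notin s -> num l.1 = xi i ->
  dwpf (i :: s) (l :: ls) =
  wt_c rho l (inh i) * (\prod_(j <- s) wt_a l (inh j)) * dwpf s ls.
Proof.
move=> nis li; rewrite /dwpf {1}/opCs_iter /= -[foldl _ _ _]/(opCs_iter _ _ _).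
rewrite opCs_cons_ket // ?ffunE ?mem_head // => [|j js]; last first.
  by rewrite ffunE inE js orbT.
rewrite opCs_iter_lincomb ffunE.
have -> : wt_b rho l (inh i) = 0 by rewrite /wt_b li subrr mul0r mulr0.
rewrite mul0r add0r.
have -> : set_config (domain_wall (i :: s)) i e1 = domain_wall s.
  apply/ffunP=> x; rewrite !ffunE inE; case: eqVneq => [->|//].
  by rewrite (negPf nis).
rewrite opCs_iter_freeze // => c ci; rewrite ffunE.
by case: (eqVneq c (domain_wall s)) ci => [->|//]; rewrite ffunE (negPf nis).
Qed.

(** A single exchange takes place along the first row and contributes rt nu; every other site gives
    a factor of degree at most 1 once denominators are cleared. [P] depends on neither [nu] nor its
    root, hence also serves at the nodes. *)
Lemma dwpf_cons_poly y s ls : uniq s -> num y != 0 ->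
  exists2 P : {poly F}, (size P <= size s)%N &
  forall nu, regular (nu, y) ->
    dwpf s ((nu, y) :: ls) * \prod_(i <- s) wt_den rho (nu, y) (inh i) =
    rt nu * P.[num nu].
Proof.
move=> Us y0; rewrite /dwpf.
(* Induction on the sites [s'] visited by the first C only; the later operators keep the full list
   [s]. *)
suff: forall (c : config 'I_M) s', uniq s' -> (forall j, j \in s' -> c j = e2) ->
  exists2 P : {poly F}, (size P <= size s')%N &
  forall nu, regular (nu, y) ->
    opCs_iter s ls (opCs rho inh s' (nu, y) (ket F c)) [ffun=> e1]
    * \prod_(i <- s') wt_den rho (nu, y) (inh i) = rt nu * P.[num nu].
  by move/(_ (domain_wall s) s Us); apply=> j js; rewrite ffunE js.
move=> c; elim=> [|i s' IHs'] /=.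
  move=> _ _; exists 0; rewrite ?size_poly0 // => nu _.
  rewrite /opCs /transfer /= aux_coord_tensor opCs_iter_lincomb !ffunE horner0.
  by rewrite ord2_neq mulr0 !mul0r addr0 mul0r.
case/andP=> nis' Us' cs'.
have [P sP PE] : exists2 P : {poly F}, (size P <= size s')%N &
  forall nu, regular (nu, y) ->
    opCs_iter s ls (opCs rho inh s' (nu, y) (ket F c)) [ffun=> e1]
    * \prod_(i <- s') wt_den rho (nu, y) (inh i) = rt nu * P.[num nu].
  by apply: IHs' => // j js; apply: cs'; rewrite inE js orbT.
pose W := opCs_iter s ls (ket F (set_config c i e1)) [ffun=> e1].
(* The weight of the exchange at [i], stripped of rt nu and of its denominator. *)
pose k := (num rho - 1) * (rt (inh i).2 / rt y) * rt (inh i).1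
          * \prod_(j <- s') (z j / num y) * W.
exists ((rt rho / num y) *: (P * ('X - (xi i)%:P))
        + k *: \prod_(j <- s') (num rho *: 'X - (xi j)%:P)).
  apply: (leq_trans (size_polyD _ _)); rewrite geq_max.
  apply/andP; split; apply: (leq_trans (size_scale_leq _ _)).
    by apply: (leq_trans (size_polyMleq _ _)); rewrite size_XsubC addn2.
  elim: {Us' nis' cs' PE sP k IHs'} s' => [|j s' IH]; first by rewrite big_nil size_poly1.
  rewrite big_cons; apply: (leq_trans (size_polyMleq _ _)).
  apply: (@leq_trans (2 + (size s').+1).-1) => //.
  rewrite -!subn1 leq_sub2r // leq_add //.
  apply: (leq_trans (size_polyD _ _)); rewrite size_polyN geq_max.
  rewrite (leq_trans (size_scale_leq _ _)) ?size_polyX //.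
  by rewrite (leq_trans (size_polyC_leq1 _)).
move=> nu reg; rewrite opCs_cons_ket ?cs' ?mem_head // => [|j js]; last first.
  by apply: cs'; rewrite inE js orbT.
rewrite opCs_iter_lincomb ffunE -/W big_cons.
rewrite hornerD !hornerZ hornerM hornerXsubC.
have -> : (\prod_(j <- s') (num rho *: 'X - (xi j)%:P)).[num nu] =
    \prod_(j <- s') wt_den rho (nu, y) (inh j).
  rewrite horner_prod; apply: eq_bigr => j _.
  by rewrite hornerD hornerN hornerZ hornerX hornerC mulrC.
have di : wt_den rho (nu, y) (inh i) != 0 by case: reg.
have y0' := rt_neq0 y0.
rewrite mulrDr [rt nu * (_ * (P.[_] * _))]mulrCA [rt nu * (P.[_] * _)]mulrA -PE //.
rewrite /wt_b /wt_c /k /wt_a /=; move: di y0 y0'; rewrite /=.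
set d := wt_den _ _ _; move=> di y0 y0'.
by field; rewrite y0 y0' di.
Qed.

(** The labelling [f] makes the induction on [n] possible inside a fixed space of [M] sites. *)
Lemma dwpf_izergin n (f : 'I_n -> 'I_M) (l : 'I_n -> spectral F) :
    injective f -> (forall k, regular (l k)) -> (forall k, num (l k).1 != 0) ->
    injective (fun k => num (l k).1) -> (forall k i, num (l k).1 != xi i) ->
  dwpf (map f (enum 'I_n)) (map l (enum 'I_n)) =
  zwt (map f (enum 'I_n)) / ywt (map l (enum 'I_n))
  * (\prod_k rt (l k).1 * \prod_k rt (inh (f k)).1)
  * izergin (num rho) (fun k => num (l k).1) (fun k => xi (f k)).
Proof.
elim: n f l => [|n IHn] f l f_inj regl nu0 nu_inj nuDxi.
  have E0 : enum 'I_0 = [::] by apply: size0nil; rewrite size_enum_ord.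
  rewrite E0 /izergin /vdm !big_ord0 det_mx00 /dwpf /= ffunE.
  rewrite (_ : _ == _); first by rewrite !(mulr1, divr1).
  by apply/eqP/ffunP=> x; rewrite !ffunE.
set s := map f _; pose l0 := l ord0; pose ls := map (fun k => l (lift ord0 k)) (enum 'I_n).
have -> : map l (enum 'I_n.+1) = l0 :: ls by rewrite enum_ordSl /= -map_comp.
have size_ls : size ls = n by rewrite size_map size_enum_ord.
have Us : uniq s by rewrite map_inj_uniq ?enum_uniq.
have [y0 d0] := regl ord0.
have prod_s (g : 'I_M -> F) : \prod_(i <- s) g i = \prod_k g (f k).
  by rewrite /s big_map big_enum.
have [P sP PE] := dwpf_cons_poly ls Us y0.
have reg_ls : all_regular ls.
  by rewrite /ls; elim: (enum 'I_n) => //= k ks; split.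
have rt_xi0 i : rt (inh i).1 != 0 by rewrite rt_neq0.
pose R := \prod_(k < n) rt (l (lift ord0 k)).1.
have R0 : R != 0 by apply/prodf_neq0 => k _; rewrite rt_neq0.
(* The expected prefactor without rt nu_1, which [PE] already splits off. *)
pose K := zwt s / ywt (l0 :: ls) * (R * \prod_k rt (inh (f k)).1).
have K0 : K != 0.
  rewrite !mulf_neq0 ?invr_neq0 ?zwt_neq0 ?ywt_neq0 //.
  by apply/prodf_neq0 => k _.
have den0 : \prod_k (num l0.1 * num rho - xi (f k)) != 0.
  by apply/prodf_neq0 => k _; apply: d0.
have interp : (K^-1 *: P).[num l0.1] =
    \prod_k (num l0.1 * num rho - xi (f k)) *
    izergin (num rho) (fun k => num (l k).1) (fun k => xi (f k)).
  apply: (izergin_interpolation (nu := fun k => num (l k).1)) => //.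
  - by move=> i k /xi_inj/f_inj.
  - by move=> i k; have [_ /(_ (f k))] := regl i; rewrite subr_eq0.
  - rewrite (leq_trans (size_scale_leq _ _)) // (leq_trans sP) //.
    by rewrite size_map size_enum_ord.
  move=> j; have [s1 [s2 [E1 E2]]] := enum_ord_lift j.
  have sjE : map (fun k => f (lift j k)) (enum 'I_n) = map f s1 ++ map f s2.
    by rewrite -map_cat -E2 -map_comp.
  have sE' : s = map f s1 ++ f j :: map f s2 by rewrite /s E1 map_cat.
  (* The first spectral parameter moved to the node xi_j, with the root chosen for xi_j and with y_1
     kept. *)
  pose lj := ((inh (f j)).1, l0.2).
  have reg_lj : regular lj by split=> // i; apply: xiMrho.
  have nsj : f j \notin map f s1 ++ map f s2.
    by rewrite -sjE; apply/mapP => -[k _ /f_inj/eqP]; rewrite (negPf (neq_lift _ _)).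
  have := @dwpf_front (map f s1) (map f s2) (f j) (lj :: ls).
  rewrite -sE' dwpf_cons_node // prod_wt_a => /(_ Us (conj reg_lj reg_ls)).
  rewrite /= -sjE size_map size_enum_ord.
  rewrite IHn => [||k|k|i k /nu_inj/lift_inj|k i] //; last by move=> i k /f_inj/lift_inj.
  have := PE (inh (f j)).1 reg_lj; rewrite prod_s.
  rewrite -/lj hornerZ /K /= size_ls -/R.
  rewrite /wt_c /= !(bigD1_ord j) //=.
  set D := dwpf s _; set Pj := P.[_].
  (* At the node [wt_c] reduces to a ratio of roots of z and y, and this cleared denominator
     supplies the factor rho - 1 of the prescribed value. *)
  rewrite [wt_den rho lj (inh (f j))](_ : _ = rt (inh (f j)).1 ^+ 2 * (num rho - 1));
    last by rewrite rtP mulrBr mulr1.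
  rewrite [\prod_(i < n) (xi (f j) * _ - _)](_ : _ =
    \prod_(i < n) wt_den rho lj (inh (f (lift j i)))) // -/ls.
  set sj := map _ _; set Z := \prod_(i <- sj) _.
  set X := \prod_(k < n) rt _; set Q := \prod_(k < n) wt_den _ _ _.
  set J := izergin _ _ _.
  have Z0 : Z != 0 by rewrite prodf_seq_neq0; apply/allP => i _ /=.
  have X0 : X != 0 by apply/prodf_neq0 => k _.
  have zs0 := zwt_neq0 s; have zsj0 := zwt_neq0 sj; have yls0 := ywt_neq0 reg_ls.
  have rz0 := rt_neq0 (z0 (f j)); have ry0 := rt_neq0 y0.
  have yn0 : num l0.2 ^+ n != 0 by rewrite expf_neq0.
  have x0 := rt_xi0 (f j).
  have r0 : num rho - 1 != 0 by rewrite subr_eq0.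
  (* The first equation expresses the value of [P] through [D], and [DE] expresses [D] through the
     partition function with one site fewer. *)
  move=> /esym/(canRL (mulKf x0)) -> DE.
  have {DE} -> := canRL (mulfK (mulf_neq0 (mulf_neq0 rz0 Z0) zsj0)) DE.
  rewrite -/l0 in ry0.
  by field; rewrite zsj0 Z0 rz0 yls0 yn0 r0 x0 ry0 X0 R0 zs0.
have nu_P : regular (l0.1, l0.2) by split.
have := PE l0.1 nu_P; rewrite prod_s -surjective_pairing => PE0.
apply: (mulIf den0); rewrite [LHS]PE0.
have -> : P.[num l0.1] = K * (K^-1 *: P).[num l0.1].
  by rewrite hornerZ mulVKf.
rewrite interp /K [\prod_k rt (l k).1]big_ord_recl -/l0 -/R; ring.
Qed.

(** A site collects two roots from each site before it and one of its own. *)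
Lemma zwt_map_enum n (f : 'I_n -> 'I_M) :
  zwt (map f (enum 'I_n)) = \prod_(i < n) rt (inh (f i)).2 ^+ (2 * i).+1.
Proof.
elim: n f => [|n IHn] f.
  by rewrite big_ord0 (size0nil (size_enum_ord 0)).
rewrite enum_ordSl /= -map_comp IHn big_map big_enum /= big_ord_recl muln0 expr1.
rewrite -mulrA -big_split /=; congr (_ * _); apply: eq_bigr => i _.
by rewrite -[num _]rtP -exprD /bump add1n mulnS addnS.
Qed.

Lemma ywt_map_enum n (l : 'I_n -> spectral F) :
  ywt (map l (enum 'I_n)) = \prod_(i < n) rt (l i).2 ^+ (2 * (n - i) - 1)%N.
Proof.
elim: n l => [|n IHn] l.
  by rewrite big_ord0 (size0nil (size_enum_ord 0)).
rewrite enum_ordSl /= -map_comp IHn size_map size_enum_ord big_ord_recl.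
rewrite subn0 mulnS subn1 /= -rtP -exprM -exprS; congr (_ * _).
Qed.
End PartitionFunction.

(** * Return to the operators and products of the statement *)

Lemma dwpf_CE (F : fieldType) M (rho : rooted F) (inh l : 'I_M -> spectral F) :
  dwpf_C rho inh l = dwpf rho inh (enum 'I_M) (map l (enum 'I_M)).
Proof.
rewrite /dwpf_C /bra (bigD1 [ffun=> e1]) //= big1 => [|c /negPf c1]; last first.
  by rewrite ffunE c1 mul0r.
rewrite ffunE eqxx mul1r addr0 /dwpf.
have -> : uniform_vec F M e2 = ket F (domain_wall (enum 'I_M)).
  apply/ffunP=> c; rewrite !ffunE; congr (_ == _)%:R.
  by apply/ffunP=> x; rewrite !ffunE mem_enum.
congr (fun_of_fin _ _); rewrite /opCs_iter; set v := ket F _.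
by elim: {1 3}(enum 'I_M) v => //= m ms IHms v; apply: IHms.
Qed.

Theorem mainTheorem8 (R : realType) (M : nat)
    (rho : rooted R[i]) (nu y xi z : 'I_M -> rooted R[i])
    (hM : (1 <= M)%N)
    (hrho0 : num rho != 0) (hrho1 : num rho != 1)
    (hnu0 : forall m, num (nu m) != 0) (hy0 : forall m, num (y m) != 0)
    (hxi0 : forall m, num (xi m) != 0) (hz0 : forall m, num (z m) != 0)
    (hnu : forall i j, i != j -> num (nu i) != num (nu j))
    (hxi : forall i j, i != j -> num (xi i) != num (xi j))
    (hnuxi : forall i j, num (nu i) != num (xi j))
    (hnurhoxi : forall i j, num (nu i) * num rho != num (xi j))
    (hxirhoxi : forall i j, i != j -> num (xi i) * num rho != num (xi j)) :
  dwpf_C rho (fun m => (xi m, z m)) (fun m => (nu m, y m)) =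
    (* i ranges over 0, ..., M - 1 and [rev_ord i] is M - 1 - i *)
    (\prod_(i < M) (rt (z (rev_ord i)) / rt (y i)) ^+ (2 * (M - i) - 1)%N)
    * (((\prod_(k < M) (rt (nu k) * rt (xi k)))
        * (\prod_(m < M) \prod_(n < M) (num (nu m) - num (xi n))))
       / (\prod_(p < M) \prod_(q < M | (p < q)%N)
            ((num (nu p) - num (nu q)) * (num (xi q) - num (xi p)))))
    * \det (\matrix_(i < M, j < M)
              ((num rho - 1) /
               ((num (nu i) * num rho - num (xi j))
                * (num (nu i) - num (xi j))))).
Proof.
have regl m : regular rho (fun m => (xi m, z m)) (nu m, y m).
  by split=> [|i]; [apply: hy0 | rewrite subr_eq0; apply: hnurhoxi].
have nu_inj : injective (fun k => num (nu k)).
  by move=> i j /eqP; apply: contraTeq => /hnu.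
have xi_inj : injective (fun k => num (xi k)).
  by move=> i j /eqP; apply: contraTeq => /hxi.
have xiMrho i k : wt_den rho (xi i, z i) (xi k, z k) != 0.
  (* On the diagonal the value is xi_i (rho - 1), nonzero since xi_i is nonzero and rho is not 1. *)
  rewrite subr_eq0; case: (eqVneq i k) => [->|/hxirhoxi //] /=.
  by rewrite -subr_eq0 -{2}[num _]mulr1 -mulrBr mulf_neq0 ?subr_eq0.
rewrite dwpf_CE.
have E : enum 'I_M = map id (enum 'I_M) by rewrite map_id.
rewrite {1}E (dwpf_izergin _ _ _ _ _ _ (f := id)) //.
rewrite zwt_map_enum ywt_map_enum /=.
(* Reversing the sites pairs z_(M-1-i) with y_i under a common exponent. *)
have -> : \prod_(i < M) rt (z i) ^+ (2 * i).+1 =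
    \prod_(i < M) rt (z (rev_ord i)) ^+ (2 * (M - i) - 1)%N.
  rewrite (reindex_inj rev_ord_inj); apply: eq_bigr => i _; congr (_ ^+ _).
  by rewrite /= -[in RHS](subnSK (ltn_ord i)) mulnS addSn subn1.
rewrite -prodf_div -[in LHS]big_split /= /izergin mulrA; congr (_ * _).
rewrite -mulrA; congr (_ * _).
  by apply: eq_bigr => i _; rewrite expr_div_n.
rewrite mulrA; congr (_ / _); rewrite -big_split; apply: eq_bigr => p _.
by rewrite -big_split; apply: eq_bigr => q _; rewrite /= opprK [- _ + _]addrC.
Qed.
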